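(* Let $p$ be a prime. Then: (a) For every $i \ge 1$, $\mathcal{C}^i(\mathbb{F}_p) = \mathcal{C}^i_p \cup \mathcal{C}^{i+1}_p$. (b) $\mathcal{C}^0(\mathbb{F}_p)$ is the disjoint union of $\mathcal{C}^0(\mathbb{Z})$ and $\mathcal{C}^1_p$.
   Context: $\Sigma_n$ is the symmetric group on $n$ letters, and $\lambda \vdash n$ means that $\lambda$ is a partition of $n$. For a commutative ring $R$, $S^\lambda_R$ is the Specht module over $R$ in James' convention (the $R\Sigma_n$-submodule of the permutation module on $\lambda$-tabloids spanned by polytabloids, so $S^{(n)}_R$ is trivial); $S^\lambda_{\mathbb{Z}}$ is free of finite rank over $\mathbb{Z}$ and $S^\lambda_{\mathbb{F}_p} \cong S^\lambda_{\mathbb{Z}}/pS^\lambda_{\mathbb{Z}}$. $H^i(\Sigma_n, -)$ is group cohomology; $H^i(\Sigma_n,S^\lambda_{\mathbb{Z}})$ is finite for $i\ge 1$. For $R \in \{\mathbb{Z},\mathbb{F}_p\}$ and $i \ge 0$ put $\mathcal{C}^i(R) := \bigcup_{n \in \mathbb{Z}_{\ge 0}} \{\lambda \vdash n \mid H^i(\Sigma_n, S^\lambda_R) \ne 0\}$, and for $i \ge 1$ put $\mathcal{C}^i_p := \bigcup_{n \in \mathbb{Z}_{\ge 0}} \{\lambda \vdash n \mid p \text{ divides } |H^i(\Sigma_n,S^\lambda_{\mathbb{Z}})|\}$. *)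

(* Defs.v *)
From HB Require Import structures.
From mathcomp Require Import all_boot all_order all_fingroup all_algebra.
From mathcomp Require Import all_classical.

Set Implicit Arguments.
Unset Strict Implicit.
Unset Printing Implicit Defensive.

Import GRing.Theory.
Local Open Scope ring_scope.

Record gmodule (G : finGroupType) := GModule {
  gcarrier :> zmodType;
  gact : G -> gcarrier -> gcarrier;
  gactB : forall g x y, gact g (x - y) = gact g x - gact g y;
  gact1 : forall x, gact 1%g x = x;
  gactM : forall g h x, gact (g * h)%g x = gact g (gact h x) }.

Section Cohomology.
Variables (G : finGroupType) (M : gmodule G).

(* Inhomogeneous cochains: H^i is computed from the bar resolution. *)
Definition cochain (i : nat) := {ffun i.-tuple G -> M}.

(* (g_0, .., g_i) |-> (g_0, .., g_j g_{j+1}, .., g_i).  The indices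
   [lift ord_max k] and [lift ord0 k] have values k and k + 1 respectively. *)
Definition merge_at (i : nat) (j : 'I_i) (s : i.+1.-tuple G) : i.-tuple G :=
  [tuple if (k < j)%N then tnth s (lift ord_max k)
         else if k == j then (tnth s (lift ord_max k) * tnth s (lift ord0 k))%g
         else tnth s (lift ord0 k) | k < i].

Definition drop_first (i : nat) (s : i.+1.-tuple G) : i.-tuple G :=
  [tuple tnth s (lift ord0 k) | k < i].

Definition drop_last (i : nat) (s : i.+1.-tuple G) : i.-tuple G :=
  [tuple tnth s (lift ord_max k) | k < i].

Definition coboundary (i : nat) (f : cochain i) : cochain i.+1 :=
  [ffun s : i.+1.-tuple G =>
     gact (tnth s ord0) (f (drop_first s))
     + \sum_(j < i) f (merge_at j s) *~ (-1) ^+ j.+1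
     + f (drop_last s) *~ (-1) ^+ i.+1].

Lemma coboundaryB (i : nat) (f g : cochain i) :
  coboundary (f - g) = coboundary f - coboundary g.
Proof.
apply/ffunP=> s; rewrite !ffunE gactB mulrzBl.
rewrite (eq_bigr (fun j => f (merge_at j s) *~ (-1) ^+ j.+1
    - g (merge_at j s) *~ (-1) ^+ j.+1)) => [|j _]; last by rewrite !ffunE mulrzBl.
by rewrite sumrB !opprD [RHS]addrACA; congr (_ + _); exact: addrACA.
Qed.

Lemma coboundary0 (i : nat) : coboundary (0 : cochain i) = 0.
Proof. by rewrite -(subrr 0) coboundaryB subrr. Qed.

Definition cocycle_pred (i : nat) : {pred cochain i} :=
  [pred f : cochain i | coboundary f == 0].

Fact cocycle_zmod_closed (i : nat) : zmod_closed (@cocycle_pred i).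
Proof.
split=> [|f g]; rewrite !inE ?coboundary0 //.
by move=> /eqP df /eqP dg; rewrite coboundaryB df dg subrr.
Qed.

HB.instance Definition _ (i : nat) :=
  GRing.isZmodClosed.Build (cochain i) (@cocycle_pred i)
    (cocycle_zmod_closed i).

Record cocycle (i : nat) :=
  Cocycle { cocycle_val : cochain i; _ : cocycle_val \in @cocycle_pred i }.
HB.instance Definition _ (i : nat) := [isSub for @cocycle_val i].
HB.instance Definition _ (i : nat) := [Choice of cocycle i by <:].
HB.instance Definition _ (i : nat) :=
  [SubChoice_isSubZmodule of cocycle i by <:].

Definition is_coboundary (i : nat) : cochain i -> Prop :=
  match i with
  | 0 => fun f => f = 0
  | j.+1 => fun f => exists h : cochain j, f = coboundary h
  end.

Definition boundary_pred (i : nat) : {pred cocycle i} :=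
  [pred z : cocycle i | `[< is_coboundary (val z) >]].

Fact boundary_zmod_closed (i : nat) : zmod_closed (@boundary_pred i).
Proof.
case: i => [|i]; split=> [|x y]; rewrite !inE /=.
- by [].
- by move=> -> ->; rewrite subrr.
- by exists 0; rewrite coboundary0.
by move=> [h ->] [k ->]; exists (h - k); rewrite coboundaryB.
Qed.

HB.instance Definition _ (i : nat) :=
  GRing.isZmodClosed.Build (cocycle i) (@boundary_pred i)
    (boundary_zmod_closed i).

Definition cohomology (i : nat) : zmodType := Quotient.quot (@boundary_pred i).

End Cohomology.

Definition is_partition (n : nat) (la : seq nat) : bool :=
  [&& sorted geq la, 0%N \notin la & sumn la == n].

(* The nodes of the Young diagram; rows and columns are numbered from 0. *)
Definition node (la : seq nat) := {r : 'I_(size la) & 'I_(nth 0%N la r)}.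
Definition node_row (la : seq nat) (x : node la) : 'I_(size la) := tag x.
Definition node_col (la : seq nat) (x : node la) : nat := tagged x.

(* A tableau is recorded by the position of each letter.  When la is a
   partition of n there are n nodes, so an injective t is bijective. *)
Definition tableau (n : nat) (la : seq nat) :=
  {t : {ffun 'I_n -> node la} | injectiveb t}.

Definition row_map (n : nat) (la : seq nat) (t : tableau n la) :
  {ffun 'I_n -> 'I_(size la)} := [ffun i => node_row (val t i)].

(* Two tableaux are row equivalent iff each letter lies in the same row of
   both, so a row-equivalence class is recorded by the common row map. *)
Definition tabloid (n : nat) (la : seq nat) :=
  {T : {ffun 'I_n -> 'I_(size la)} | [exists t : tableau n la, T == row_map t]}.

Section Specht.
Variables (n : nat) (la : seq nat).
Implicit Types (g h s : 'S_n) (t : tableau n la) (T : tabloid n la).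

Fact tabloid_of_subproof t :
  [exists t' : tableau n la, row_map t == row_map t'].
Proof. by apply/existsP; exists t. Qed.

Definition tabloid_of t : tabloid n la := Sub (row_map t) (tabloid_of_subproof t).

(* MathComp permutations compose from left to right, (g * h) i = h (g i), so
   letters carry a right action of 'S_n; the left action of g used here
   replaces each letter i by g^-1 i, that is, puts i where g i was. *)
Fact tableau_act_subproof g t : injectiveb [ffun i => val t (g i)].
Proof.
apply/injectiveP => i j; rewrite !ffunE => /(injectiveP _ (valP t)).
exact: perm_inj.
Qed.

Definition tableau_act g t : tableau n la :=
  Sub [ffun i => val t (g i)] (tableau_act_subproof g t).

Fact tabloid_act_subproof g T :
  [exists t : tableau n la, [ffun i => val T (g i)] == row_map t].
Proof.
have /existsP[t /eqP Tt] := valP T; apply/existsP; exists (tableau_act g t).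
by apply/eqP/ffunP => i; rewrite Tt !ffunE.
Qed.

Definition tabloid_act g T : tabloid n la :=
  Sub [ffun i => val T (g i)] (tabloid_act_subproof g T).

Definition col_stab t : {set 'S_n} :=
  [set s : 'S_n | [forall i, node_col (val t (s i)) == node_col (val t i)]].

Variable R : comNzRingType.

Definition perm_module := {ffun tabloid n la -> R^o}.

Definition basis_elt T : perm_module := [ffun T' => (T' == T)%:R].

Definition perm_module_act g (m : perm_module) : perm_module :=
  [ffun T => m (tabloid_act g^-1%g T)].

Definition polytabloid t : perm_module :=
  \sum_(s in col_stab t) (-1) ^+ s *: basis_elt (tabloid_act s (tabloid_of t)).

Definition specht_pred : {pred perm_module} :=
  [pred m : perm_module |
    `[< exists c : tableau n la -> R, m = \sum_t c t *: polytabloid t >]].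

Fact specht_submod_closed : submod_closed specht_pred.
Proof.
split=> [|a x y]; rewrite !inE.
  by exists (fun=> 0); rewrite big1 // => t _; rewrite scale0r.
move=> [c ->] [d ->].
exists (fun t => a * c t + d t); rewrite scaler_sumr -big_split /=.
by apply: eq_bigr => t _; rewrite scalerDl scalerA.
Qed.

HB.instance Definition _ :=
  GRing.isSubmodClosed.Build R perm_module specht_pred specht_submod_closed.

Record specht := Specht { specht_val : perm_module; _ : specht_val \in specht_pred }.
HB.instance Definition _ := [isSub for specht_val].
HB.instance Definition _ := [Choice of specht by <:].
HB.instance Definition _ := [SubChoice_isSubLmodule of specht by <:].

Lemma tabloid_actM g h T :
  tabloid_act (g * h)%g T = tabloid_act g (tabloid_act h T).
Proof. by apply/val_inj/ffunP => i; rewrite /= !ffunE permM. Qed.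

Lemma tabloid_act1 T : tabloid_act 1%g T = T.
Proof. by apply/val_inj/ffunP => i; rewrite /= !ffunE perm1. Qed.

Lemma tabloid_actK g : cancel (tabloid_act g) (tabloid_act g^-1%g).
Proof. by move=> T; rewrite -tabloid_actM mulVg tabloid_act1. Qed.

Lemma tabloid_actVK g : cancel (tabloid_act g^-1%g) (tabloid_act g).
Proof. by move=> T; rewrite -tabloid_actM mulgV tabloid_act1. Qed.

Lemma perm_module_act_linear g : linear (perm_module_act g).
Proof. by move=> a x y; apply/ffunP => T; rewrite !ffunE. Qed.

HB.instance Definition _ g :=
  GRing.isLinear.Build R perm_module perm_module _ (perm_module_act g)
    (perm_module_act_linear g).

Lemma perm_module_act1 m : perm_module_act 1%g m = m.
Proof. by apply/ffunP => T; rewrite ffunE invg1 tabloid_act1. Qed.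

Lemma perm_module_actM g h m :
  perm_module_act (g * h)%g m = perm_module_act g (perm_module_act h m).
Proof. by apply/ffunP => T; rewrite !ffunE invMg tabloid_actM. Qed.

Lemma perm_module_act_basis g T :
  perm_module_act g (basis_elt T) = basis_elt (tabloid_act g T).
Proof.
apply/ffunP => T'; rewrite !ffunE; congr (_%:R).
by rewrite -(can_eq (tabloid_actK g)) tabloid_actVK.
Qed.

Lemma tabloid_of_act g t : tabloid_of (tableau_act g t) = tabloid_act g (tabloid_of t).
Proof. by apply/val_inj/ffunP => i; rewrite /= !ffunE. Qed.

Lemma perm_module_act_polytabloid g t :
  perm_module_act g (polytabloid t) = polytabloid (tableau_act g t).
Proof.
rewrite /polytabloid linear_sum /=.
rewrite [RHS](reindex_inj (conjg_inj g^-1%g)) /=; apply: eq_big => [s|s _].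
  rewrite !inE; apply/forallP/forallP => Hs i.
    have := Hs (g i).
    by rewrite /= !ffunE conjgE invgK !permM permKV.
  have := Hs (g^-1%g i).
  by rewrite /= !ffunE conjgE invgK !permM !permKV.
rewrite linearZ /= perm_module_act_basis odd_permJ; congr (_ *: basis_elt _).
by rewrite tabloid_of_act -!tabloid_actM conjgE invgK -!mulgA mulVg mulg1.
Qed.

Fact specht_act_subproof g (m : specht) :
  perm_module_act g (val m) \in specht_pred.
Proof.
have /asboolP[c ->] := valP m; apply/asboolP.
exists (fun t => c (tableau_act g^-1%g t)); rewrite linear_sum /=.
have K (k : 'S_n) : cancel (tableau_act k) (tableau_act k^-1%g).
  by move=> t; apply/val_inj/ffunP => i; rewrite /= !ffunE permKV.
rewrite [RHS](reindex_inj (can_inj (K g))) /=; apply: eq_bigr => t _.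
by rewrite K linearZ /= perm_module_act_polytabloid.
Qed.

Definition specht_act g (m : specht) : specht :=
  Specht (specht_act_subproof g m).

Fact specht_actB g x y : specht_act g (x - y) = specht_act g x - specht_act g y.
Proof. by apply: val_inj; rewrite raddfB /= raddfB. Qed.

Fact specht_act1 x : specht_act 1%g x = x.
Proof. by apply: val_inj; rewrite /= perm_module_act1. Qed.

Fact specht_actM g h x : specht_act (g * h)%g x = specht_act g (specht_act h x).
Proof. by apply: val_inj; rewrite /= perm_module_actM. Qed.

Definition specht_module : gmodule 'S_n :=
  GModule specht_actB specht_act1 specht_actM.

End Specht.

Local Open Scope classical_set_scope.
Local Open Scope card_scope.

Definition C_coeff (i : nat) (R : comNzRingType) : set (seq nat) :=
  \bigcup_(n : nat) [set la | is_partition n la /\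
    exists x : cohomology (specht_module n la R) i, x != 0].

(* The group is required to be finite, of some order k divisible by p. *)
Definition C_tors (i p : nat) : set (seq nat) :=
  \bigcup_(n : nat) [set la | is_partition n la /\
    exists2 k : nat, [set: cohomology (specht_module n la int) i] #= `I_k
                   & (p %| k)%N].

(* Main.v *)
From HB Require Import structures.
From mathcomp Require Import all_boot all_order all_fingroup all_algebra.
From mathcomp Require Import all_solvable.
From mathcomp Require Import all_classical zify.
Require Import Defs.

(** The theorem is the universal coefficient argument for the sequence
    0 -> S_Z -p-> S_Z -> S_Fp -> 0, where S is the Specht module of a fixed
    partition.

    Exactness.  Only the middle is not formal: an element of S_Z all of whose
    coefficients are divisible by m must be m times an element of S_Z.  This is
    obtained by describing S_R, over every commutative ring R, as the solution
    set of linear equations whose coefficients are 0 and 1 (the Garnir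
    equations: certain sums of coefficients vanish).  Such a solution set over
    Z is closed under division.  Polytabloids solve the equations because two
    of the letters that are summed over share a column, and exchanging them
    reverses signs ([garnir_polytabloid]).  Conversely, if v solves the
    equations and T is a tabloid with v T != 0 but v T' = 0 for all larger T',
    then the rows of T, written in increasing order, form a standard tableau:
    otherwise some Garnir equation has T as its smallest term
    ([not_column_standard]).  The polytabloid of that standard tableau has T as
    its largest term, with coefficient 1 ([polytabloid_leading]), so
    subtracting a multiple of it removes T, and induction shows that v is in
    S_R ([garnir_specht]).

    Cohomology.  The long exact sequence gives, for every i, that
    H^i(S_Fp) != 0 iff H^i(S_Z) is not p-divisible or H^(i+1)(S_Z) has an
    element of order p ([cohomology_mod_neq0P]).  For i >= 1 the group order
    annihilates H^i(S_Z) ([mulrn_card_is_coboundary]), so H^i(S_Z) is finite;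
    then p divides its order iff it has p-torsion (Cauchy and Lagrange) iff it
    is not p-divisible.  This proves (a).  For i = 0, the invariants
    H^0(S_Z) form a lattice, which is p-divisible only if it vanishes; this
    gives the union in (b).

    Disjointness in (b).  The symmetric group is transitive on tabloids, so a
    nonzero invariant in S_Z has all coefficients equal to some c != 0.  If
    there were two rows, the Garnir equation that redistributes all letters of
    the first two would say that a positive multiple of c is 0.  Hence there
    is at most one row, the action is trivial, and H^1(S_Z) = Hom(G, S_Z) = 0
    because G is finite and S_Z is torsion-free. *)

Set Implicit Arguments.
Unset Strict Implicit.
Unset Printing Implicit Defensive.

Import GRing.Theory Num.Theory.
Local Open Scope ring_scope.

(** * Tabloids, standardness and reshuffling *)

Section Tabloids.
Variables (n : nat) (la : seq nat).
Hypothesis la_part : is_partition n la.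
Implicit Types (T : tabloid n la) (t : tableau n la) (r : 'I_(size la)).

Definition mk_node r (c : 'I_(nth 0%N la r)) : node la :=
  Tagged (fun r : 'I_(size la) => 'I_(nth 0%N la r)) c.

Lemma card_node : #|{: node la}| = n.
Proof.
have /and3P[_ _ /eqP <-] := la_part.
rewrite card_tagged; congr sumn.
rewrite (eq_map (fun i : 'I_(size la) => card_ord (nth 0%N la i))).
rewrite (map_comp (nth 0%N la)) val_enum_ord.
by apply: (@eq_from_nth _ 0%N) => [|k]; rewrite size_map size_iota // => kn;
  rewrite (nth_map 0%N) ?size_iota // nth_iota.
Qed.

Lemma nth_partition_le r r' : (r <= r')%N -> (nth 0 la r' <= nth 0 la r)%N.
Proof.
have /and3P[la_sorted _ _] := la_part => rr'.
have geq_trans : transitive geq by move=> x y z /= xy yz; apply: leq_trans yz xy.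
by have := sorted_leq_nth geq_trans leqnn 0%N la_sorted; apply; rewrite ?inE.
Qed.

Lemma tableau_bij t : bijective (val t).
Proof.
by apply: inj_card_bij; [apply/injectiveP/(valP t) | rewrite card_ord card_node].
Qed.

Lemma card_row T r : #|[set i | val T i == r]| = nth 0%N la r.
Proof.
have /existsP[t /eqP ->] := valP T.
have [f tK fK] := tableau_bij t.
rewrite -(card_ord (nth 0%N la r)).
rewrite -(card_imset _ (can_inj tK)) -[RHS]cardsT.
have inj_r : injective (@mk_node r).
  by move=> x y /eqP; rewrite eq_Tagged => /eqP.
rewrite -(card_imset _ inj_r); apply: eq_card => x.
apply/imsetP/imsetP => [[i]|[j _ ->]].
  rewrite inE ffunE /node_row => /eqP <- ->.
  by exists (tagged (val t i)); rewrite ?inE //; case: (val t i).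
exists (f (mk_node j)); last by rewrite fK.
by rewrite inE ffunE fK.
Qed.

(** The column of a letter when each row is written in increasing order. *)
Definition row_rank T (i : 'I_n) : nat :=
  #|[set j : 'I_n | (j < i)%N && (val T j == val T i)]|.

Lemma row_rank_ltn T i : (row_rank T i < nth 0 la (val T i))%N.
Proof.
rewrite -(card_row T); apply: proper_card; apply/properP; split.
  by apply/fintype.subsetP => j; rewrite !inE => /andP[].
by exists i; rewrite !inE ?eqxx // ltnn.
Qed.

Definition row_node T (i : 'I_n) : node la :=
  mk_node (Ordinal (row_rank_ltn T i)).

Lemma row_rank_mono T i j : val T i = val T j -> (i < j)%N ->
  (row_rank T i < row_rank T j)%N.
Proof.
move=> Tij ij; apply: proper_card; apply/properP; split.
  by apply/fintype.subsetP => k; rewrite !inE Tij => /andP[/ltn_trans-> //].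
by exists i; rewrite !inE ?ltnn // ij Tij eqxx.
Qed.

Lemma row_rank_inj T i j : val T i = val T j -> row_rank T i = row_rank T j ->
  i = j.
Proof.
move=> Tij eq_ij; apply: val_inj => /=; case: (ltngtP i j) => // ij.
  by have := row_rank_mono Tij ij; rewrite eq_ij ltnn.
by have := row_rank_mono (esym Tij) ij; rewrite eq_ij ltnn.
Qed.

Fact row_node_inj T : injectiveb [ffun i => row_node T i].
Proof.
apply/injectiveP => i j; rewrite !ffunE => eq_ij.
have := congr1 (fun x : node la => node_row x) eq_ij.
have := congr1 (fun x : node la => node_col x) eq_ij.
by move=> /= eq_col eq_row; apply: row_rank_inj eq_row eq_col.
Qed.

Definition row_tableau T : tableau n la := exist _ [ffun i => row_node T i] (row_node_inj T).

Lemma row_tableauK T : tabloid_of (row_tableau T) = T.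
Proof. by apply/val_inj/ffunP => i; rewrite /= !ffunE. Qed.

Lemma row_tableau_col T i : node_col (val (row_tableau T) i) = row_rank T i.
Proof. by rewrite ffunE. Qed.

(** Row maps are compared at the largest letter on which they differ; both
    leading-term arguments below only look at the largest letter that moves. *)
Definition tabloid_lt T' T : bool :=
  [exists i, (val T' i < val T i)%N &&
     [forall j : 'I_n, (i < j)%N ==> (val T' j == val T j)]].

Lemma tabloid_ltP T' T :
  reflect (exists2 i : 'I_n, (val T' i < val T i)%N &
             forall j : 'I_n, (i < j)%N -> val T' j = val T j)
    (tabloid_lt T' T).
Proof.
apply: (iffP existsP) => [[i /andP[Ti /forallP Tj]]|[i Ti Tj]]; exists i => //.
  by move=> j ij; apply/eqP; apply: (implyP (Tj j)).
by rewrite Ti; apply/forallP => j; apply/implyP => /Tj->.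
Qed.

Lemma tabloid_ltxx T : tabloid_lt T T = false.
Proof. by apply/tabloid_ltP => -[i]; rewrite ltnn. Qed.

Lemma tabloid_lt_trans : transitive tabloid_lt.
Proof.
move=> T2 T1 T3 /tabloid_ltP[i lt_i eq_i] /tabloid_ltP[j lt_j eq_j].
apply/tabloid_ltP; case: (ltngtP i j) => ij.
- exists j => [|k jk]; first by rewrite eq_i.
  by rewrite eq_i ?eq_j // (ltn_trans ij).
- exists i => [|k ik]; first by rewrite -eq_j.
  by rewrite eq_i ?eq_j // (ltn_trans ij).
have {}ij := val_inj ij; rewrite -{}ij in lt_j eq_j *.
by exists i => [|k ik]; [apply: ltn_trans lt_j | rewrite eq_i ?eq_j].
Qed.

Lemma last_difference T T' : T != T' ->
  exists2 i : 'I_n, val T i != val T' i &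
    forall j : 'I_n, (i < j)%N -> val T j = val T' j.
Proof.
rewrite -val_eqE => /eqP neqT.
have [i0 di0] : exists i, val T i != val T' i.
  apply/existsP; apply: contraT => /existsPn eqT; case: neqT.
  by apply/ffunP => i; apply/eqP; apply: contraT => /(negP (eqT i)).
case: (arg_maxnP (P := fun i => val T i != val T' i) (fun i : 'I_n => i : nat) di0).
move=> i di maxi; exists i => // j ij; apply/eqP.
by apply: contraTT ij => dj; rewrite -leqNgt; apply: (maxi j dj).
Qed.

Definition height T : nat := #|[set T' | tabloid_lt T' T]|.

Lemma height_lt T' T : tabloid_lt T' T -> (height T' < height T)%N.
Proof.
move=> lt_T; apply: proper_card; apply/properP; split.
  by apply/fintype.subsetP => T''; rewrite !inE => /tabloid_lt_trans; apply.
by exists T'; rewrite !inE ?tabloid_ltxx.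
Qed.

(** Row standardness is built into the column numbers, so this says that
    [row_tableau T] is standard. *)
Definition column_standard T : Prop :=
  forall i j : 'I_n, row_rank T i = row_rank T j -> (i < j)%N ->
    (val T i < val T j)%N.

(** T' arises from T by redistributing the letters of D over the rows r and
    r'; these T' are the terms of a Garnir equation. *)
Definition reshuffle (r r' : 'I_(size la)) (D : {set 'I_n}) T T' : bool :=
  [forall i, if i \in D then (val T' i == r) || (val T' i == r')
             else val T' i == val T i].

Lemma reshuffleP r r' (D : {set 'I_n}) T T' :
  reflect ((forall i, i \in D -> val T' i = r \/ val T' i = r') /\
           (forall i, i \notin D -> val T' i = val T i))
    (reshuffle r r' D T T').
Proof.
apply: (iffP forallP) => [all_i|[D_i nD_i] i].
  split=> i iD; have := all_i i; rewrite ?iD ?(negPf iD); last by move/eqP.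
  by case/orP => /eqP; [left|right].
by case: ifPn => [/D_i[]->|/nD_i->]; rewrite eqxx ?orbT.
Qed.

(** If the letters b < a share a column but a lies in the higher row r, let D
    consist of a and all letters to its right in row r, together with b and all
    letters to its left in row r'.  These are one more than the length of row
    r, and each of the former exceeds each of the latter, so that T is the
    smallest among its reshufflings: at the largest letter that moves, a move
    from r' to r would overfill row r. *)
Lemma not_column_standard T : ~ column_standard T ->
  exists r r' (D : {set 'I_n}),
  [/\ (r <= r')%N, (nth 0 la r < #|D|)%N, reshuffle r r' D T T &
      forall T', reshuffle r r' D T T' -> T' != T -> tabloid_lt T T'].
Proof.
move=> /existsNP[b /existsNP[a]]; rewrite !not_implyE => -[ab_rank [ba /negP]].
rewrite -leqNgt leq_eqVlt => /orP[/eqP/val_inj/esym Tab|Tab].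
  by have := ba; rewrite (row_rank_inj Tab ab_rank) ltnn.
pose r := val T a; pose r' := val T b.
pose Da := [set x : 'I_n | (a <= x)%N && (val T x == r)].
pose Db := [set x : 'I_n | (x <= b)%N && (val T x == r')].
have rr' : r != r' by rewrite -val_eqE ltn_eqF.
have D_T i : i \in Da :|: Db -> val T i = r \/ val T i = r'.
  by rewrite !inE => /orP[]/andP[_ /eqP]; [left|right].
exists r, r', (Da :|: Db); split; first exact: ltnW.
- rewrite cardsU disjoint_setI0 ?cards0 ?subn0; last first.
    rewrite -setI_eq0; apply/eqP/setP => x; rewrite !inE.
    by case: (eqVneq (val T x) r) => [->|]; rewrite ?(negPf rr') ?andbF.
  have -> : #|Db| = (row_rank T b).+1.
    rewrite /Db (cardsD1 b) inE leqnn eqxx add1n; congr _.+1.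
    apply: eq_card => x; rewrite !inE andbA; congr (_ && _).
    by rewrite ltn_neqAle.
  rewrite addnS ltnS -(card_row T r) ab_rank addnC.
  rewrite -(cardsID [set x : 'I_n | (x < a)%N] [set i | val T i == r]).
  by rewrite leq_add // subset_leq_card //; apply/fintype.subsetP => x; rewrite !inE;
    case: ltnP; rewrite ?andbF ?andbT /=.
- by apply/reshuffleP.
move=> T' /reshuffleP[D_T' nD_T'] /last_difference[i di eq_i].
apply/tabloid_ltP; exists i; last by move=> j /eq_i.
have iD : i \in Da :|: Db by apply: contraNT di => /nD_T'->.
have [Ti|Ti] := D_T i iD; have [T'i|T'i] := D_T' i iD.
- by move: di; rewrite Ti T'i eqxx.
- by rewrite Ti T'i.
- suff : (#|[set x | val T x == r]| < #|[set x | val T' x == r]|)%N.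
    by rewrite !card_row ltnn.
  apply: proper_card; apply/properP; split; last first.
    by exists i; rewrite inE ?T'i // Ti eq_sym.
  apply/fintype.subsetP => x; rewrite !inE => /eqP Tx.
  have [xD|/nD_T'->] := boolP (x \in Da :|: Db); last by rewrite Tx.
  rewrite eq_i ?Tx //.
  move: xD iD; rewrite !inE Tx Ti (negPf rr') [r' == r]eq_sym (negPf rr') !andbF.
  rewrite eqxx !andbT orbF /= => ax /andP[ib _].
   by apply: leq_ltn_trans ib (leq_trans ba ax).
by move: di; rewrite Ti T'i eqxx.
Qed.

End Tabloids.

(** * Garnir equations characterise Specht modules *)

(** Even and odd permutations are matched explicitly, since x = - x does not
    imply x = 0 over an arbitrary ring. *)
Lemma sum_sign_tperm (T : finType) (R : pzRingType) (i j : T)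
    (P : pred {perm T}) :
  i != j -> (forall s, P (tperm i j * s)%g = P s) ->
  \sum_(s | P s) (-1) ^+ s = 0 :> R.
Proof.
move=> ij P_inv; rewrite (bigID (fun s : {perm T} => odd_perm s)) /=.
rewrite [X in _ + X](reindex_inj (mulgI (tperm i j))) /=.
rewrite [X in _ + X](eq_bigl (fun s => P s && odd_perm s)); last first.
  by move=> s; rewrite P_inv odd_permM odd_tperm ij /= negbK.
rewrite -big_split /= big1 // => s _.
by rewrite odd_permM odd_tperm ij signrN addrN.
Qed.

Section Garnir.
Variables (n : nat) (la : seq nat) (la_part : is_partition n la) (R : comNzRingType).
Implicit Types (T : tabloid n la) (t : tableau n la) (v : perm_module n la R).

Lemma polytabloidE t T :
  polytabloid R t T =
  \sum_(s in col_stab t) (T == tabloid_act s (tabloid_of t))%:R * (-1) ^+ s.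
Proof.
rewrite /polytabloid sum_ffunE; apply: eq_bigr => s _.
by rewrite !ffunE /GRing.scale /= mulrC.
Qed.

(** More letters are redistributed than row r has columns, and row r' has no
    more columns than row r. *)
Definition garnir v : Prop :=
  forall (r r' : 'I_(size la)) (D : {set 'I_n}) T,
  (r <= r')%N -> (nth 0 la r < #|D|)%N ->
  \sum_(T' | reshuffle r r' D T T') v T' = 0.

Lemma garnir_lin (a : R) v v' : garnir v -> garnir v' -> garnir (a *: v + v').
Proof.
move=> gv gv' r r' D T rr' rD.
under eq_bigr do rewrite !ffunE.
by rewrite big_split /= -scaler_sumr gv // gv' // scaler0 addr0.
Qed.

Lemma garnir_sum (I : finType) (c : I -> R) (e : I -> perm_module n la R) :
  (forall x, garnir (e x)) -> garnir (\sum_x c x *: e x).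
Proof.
move=> ge; apply: (big_ind garnir) => [r r' D T _ _|v v' gv gv'|x _].
- by rewrite big1 // => T' _; rewrite ffunE.
- by rewrite -[v]scale1r; apply: garnir_lin.
rewrite -[_ *: _]addr0; apply: garnir_lin => // r r' D T _ _.
by rewrite big1 // => T' _; rewrite ffunE.
Qed.

(** Column permutations do not change the column of a letter, so if the equation
    has any term at all, then every letter of D lies in one of the columns of
    row r.  Two letters of D therefore share a column; their transposition is in
    the column stabiliser and permutes the terms of the equation. *)
Lemma garnir_polytabloid t : garnir (polytabloid R t).
Proof.
move=> r r' D T rr' rD.
pose P s := (s \in col_stab t) &&
  reshuffle r r' D T (tabloid_act s (tabloid_of t)).
transitivity (\sum_(s | P s) (-1) ^+ s : R).
  under eq_bigr do rewrite polytabloidE.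
  rewrite exchange_big [RHS]big_mkcondr /=; apply: eq_bigr => s _.
  rewrite -mulr_suml; case: ifPn => Ps.
    rewrite (bigD1 _ Ps) /= eqxx big1 ?addr0 ?mul1r // => T' /andP[_ /negPf->] //.
  rewrite big1 ?mul0r // => T' rT'; case: eqP => // eqT'.
  by rewrite -eqT' rT' in Ps.
have [s0 /andP[]|P0] := pickP P; last by rewrite big_pred0.
rewrite inE => /forallP s0_col /reshuffleP[D_s0 _].
have col_lt i : i \in D -> (node_col (val t i) < nth 0 la r)%N.
  move=> iD; rewrite -(eqP (s0_col i)).
  have row_i : node_row (val t (s0 i)) = r \/ node_row (val t (s0 i)) = r'.
    by have := D_s0 i iD; rewrite /= !ffunE.
  apply: leq_trans (ltn_ord (tagged (val t (s0 i)))) _.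
  case: row_i; rewrite /node_row => ->; first by apply: leqnn.
  by apply: (nth_partition_le la_part).
have [i [j [iD jD ij eq_col]]] : exists i j : 'I_n,
    [/\ i \in D, j \in D, i != j & node_col (val t i) = node_col (val t j)].
  apply: contrapT => no_ij; move: rD; rewrite ltnNge => /negP; apply.
  rewrite cardE -(size_map (fun i => node_col (val t i))) -(size_iota 0 (nth 0%N la r)).
  apply: uniq_leq_size => [|c /mapP[i]]; last first.
    by rewrite mem_enum mem_iota => iD ->; apply: col_lt.
  rewrite map_inj_in_uniq ?enum_uniq // => i j; rewrite !mem_enum => iD jD eq_ij.
  by apply/eqP; apply: contraT => ij; case: no_ij; exists i, j.
apply: (@sum_sign_tperm _ R i j) ij _ => s.
have col_ij x : node_col (val t (tperm i j x)) = node_col (val t x).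
  by case: tpermP => // ->.
rewrite /P; congr (_ && _).
  rewrite !inE; apply/forallP/forallP => cs x.
    have := cs (tperm i j x); rewrite permM tpermK => /eqP->.
    by rewrite col_ij.
  by rewrite permM (eqP (cs _)) col_ij.
have D_ij x : (tperm i j x \in D) = (x \in D).
  by case: tpermP => // ->; rewrite iD jD.
apply/reshuffleP/reshuffleP => -[Ds nDs]; split=> x xD.
- by have := Ds (tperm i j x); rewrite D_ij /= !ffunE permM tpermK; apply.
- have := nDs x xD; rewrite /= !ffunE permM tpermD //.
    by apply: contraNneq xD => <-.
  by apply: contraNneq xD => <-.
- by have := Ds (tperm i j x); rewrite D_ij /= !ffunE permM; apply.
have := nDs x xD; rewrite /= !ffunE permM tpermD //.
  by apply: contraNneq xD => <-.
by apply: contraNneq xD => <-.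
Qed.

Lemma specht_garnir v : v \in @specht_pred n la R -> garnir v.
Proof. by move=> /asboolP[c ->]; apply/garnir_sum/garnir_polytabloid. Qed.

(** At the largest letter i moved by a column permutation s, the letter s i is
    smaller than i, so it lies in a higher row of the standard tableau. *)
Lemma polytabloid_leading T T' : column_standard T -> ~~ tabloid_lt T' T ->
  polytabloid R (row_tableau la_part T) T' = (T' == T)%:R.
Proof.
move=> T_std nlt; rewrite polytabloidE row_tableauK.
have id_col : (1%g : 'S_n) \in col_stab (row_tableau la_part T).
  by rewrite inE; apply/forallP => i; rewrite perm1.
rewrite (bigD1 _ id_col) /= tabloid_act1 odd_perm1 mulr1 big1 ?addr0 //.
move=> s /andP[s_col s_neq1]; case: eqP => [eqT'|]; last by rewrite mul0r.
case/negP: nlt; rewrite eqT'; apply/tabloid_ltP.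
have [i0 mv_i0] : exists i, s i != i.
  apply/existsP; apply: contraT => /existsPn fix_s; case/negP: s_neq1.
  by apply/eqP/permP => i; rewrite perm1; apply/eqP; have := fix_s i; rewrite negbK.
case: (arg_maxnP (P := fun i => s i != i) (fun i : 'I_n => i : nat) mv_i0).
move=> i mv_i maxi; exists i => [|j ij].
  have col_i : row_rank T (s i) = row_rank T i.
    have : s \in col_stab (row_tableau la_part T) := s_col.
    by rewrite inE => /forallP/(_ i)/eqP; rewrite !row_tableau_col.
  rewrite /= ffunE; apply: T_std col_i _.
  rewrite ltn_neqAle val_eqE mv_i; apply: maxi.
  by apply: contraNneq mv_i => /perm_inj->.
rewrite /= ffunE; congr (val T _); apply/eqP; apply: contraTT ij => mv_j.
by rewrite -leqNgt; apply: maxi.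
Qed.

(** All other terms of the equation from [not_column_standard] vanish. *)
Lemma garnir_not_standard v T : garnir v -> ~ column_standard T ->
  (forall T', tabloid_lt T T' -> v T' = 0) -> v T = 0.
Proof.
move=> gv /(not_column_standard la_part)[r [r' [D [rr' rD TT ltT]]]] v0.
rewrite -(gv r r' D T rr' rD) (bigD1 T TT) /= big1 ?addr0 // => T' /andP[rT' neqT].
exact/v0/ltT.
Qed.

(** Induction on a strict upper bound of the heights of the tabloids on which v
    does not vanish: all terms of maximal height are cancelled at once by
    polytabloids of standard tableaux. *)
Lemma garnir_specht v : garnir v -> v \in @specht_pred n la R.
Proof.
suff ind m : forall v, garnir v -> (forall T, (m <= height T)%N -> v T = 0) ->
    v \in @specht_pred n la R.
  move=> gv; apply: (ind #|{: tabloid n la}|.+1 v gv) => T.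
  by rewrite ltnNge max_card.
elim: m => [|m IH] {}v gv v0.
  have -> : v = 0 by apply/ffunP => T; rewrite ffunE v0.
  exact: rpred0.
pose e T := polytabloid R (row_tableau la_part T).
pose w := \sum_T (if height T == m then v T else 0) *: e T.
have eS T : e T \in @specht_pred n la R.
  apply/asboolP; exists (fun t => (t == row_tableau la_part T)%:R).
  rewrite (bigD1 (row_tableau la_part T)) //= eqxx scale1r big1 ?addr0 //.
  by move=> t /negPf->; rewrite scale0r.
have wS : w \in @specht_pred n la R by apply: rpred_sum => T _; apply: rpredZ.
have v_nonstd T : height T = m -> ~ column_standard T -> v T = 0.
  move=> hT nstd; apply: garnir_not_standard gv nstd _ => T' /height_lt.
  by rewrite hT => /v0.
rewrite -[v](subrK w) rpredD // IH //.
  rewrite -[v - w]addrC -scaleN1r; apply: garnir_lin => //.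
  exact: specht_garnir.
move=> T mT; rewrite !ffunE sum_ffunE.
have -> : \sum_T' ((if height T' == m then v T' else 0) *: e T') T =
    \sum_T' (if height T' == m then v T' else 0) * (T == T')%:R.
  apply: eq_bigr => T' _; rewrite ffunE /GRing.scale /=.
  case: eqP => [hT'|]; last by rewrite !mul0r.
  have [std|nstd] := pselect (column_standard T'); last first.
    by rewrite v_nonstd // !mul0r.
  congr (_ * _); apply: polytabloid_leading => //.
  by apply/negP => /height_lt; rewrite hT' ltnNge mT.
rewrite (bigD1 T) //= eqxx mulr1 big1 ?addr0 => [|T' neqT]; last first.
  by rewrite [T == _]eq_sym (negPf neqT) mulr0.
case: ifPn => [_|neqm]; first by rewrite subrr.
by rewrite subr0 v0 // ltn_neqAle eq_sym neqm.
Qed.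

End Garnir.

(** * The bar complex *)

HB.instance Definition _ (G : finGroupType) (M : gmodule G) (g : G) :=
  GRing.isZmodMorphism.Build M M (gact g) (gactB g).

HB.instance Definition _ (G : finGroupType) (M : gmodule G) (i : nat) :=
  GRing.isZmodMorphism.Build (cochain M i) (cochain M i.+1)
    (@coboundary G M i) (@coboundaryB G M i).

(** The indexing of sequences by all of [nat] lets one formula cover all faces:
    the first one only shifts, the last one of a sequence of length k only
    forgets the value at k - 1, and the ones in between multiply neighbours. *)
Definition face (G : finGroupType) (k : nat) (a : nat -> G) (m : nat) : G :=
  if (m.+1 < k)%N then a m
  else if m.+1 == k then (a m * a m.+1)%g
  else a m.+1.

(** The group element that acts on the value of a cochain at the k-th face. *)
Definition face_coef (G : finGroupType) (k : nat) (a : nat -> G) : G :=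
  if k is 0 then a 0%N else 1%g.

Lemma face_face (G : finGroupType) (k l : nat) (a : nat -> G) : (l <= k)%N ->
  face l (face k.+1 a) =1 face k (face l a).
Proof.
move=> lk m; rewrite /face.
by repeat case: ifP => ?; rewrite ?mulgA //; lia.
Qed.

Lemma face_coefM (G : finGroupType) (k l : nat) (a : nat -> G) : (l <= k)%N ->
  (face_coef k.+1 a * face_coef l (face k.+1 a) =
   face_coef l a * face_coef k (face l a))%g.
Proof.
rewrite /face_coef /face; case: l k => [|l] [|k] //= _.
all: by rewrite ?mul1g ?mulg1.
Qed.

Section Bar.
Variables (G : finGroupType) (M : gmodule G).

Definition eval_seq (i : nat) (f : cochain M i) (a : nat -> G) : M :=
  f [tuple a k | k < i].

Lemma cochainMn (i : nat) (f : cochain M i) (m : nat) (s : i.-tuple G) :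
  (f *+ m) s = f s *+ m.
Proof. exact: (ffunMzE f m s). Qed.

Lemma eq_eval_seq (i : nat) (f : cochain M i) (a b : nat -> G) :
  (forall k, (k < i)%N -> a k = b k) -> eval_seq f a = eval_seq f b.
Proof.
by move=> ab; congr (f _); apply: eq_mktuple => k; apply: ab.
Qed.

Lemma eval_nth (i : nat) (f : cochain M i) (s : i.-tuple G) :
  f s = eval_seq f (nth 1%g s).
Proof.
congr (f _); apply/eq_from_tnth => k.
by rewrite tnth_mktuple (tnth_nth 1%g).
Qed.

Lemma coboundaryE (i : nat) (f : cochain M i) (a : nat -> G) :
  eval_seq (coboundary f) a =
  \sum_(k < i.+2) gact (face_coef k a) (eval_seq f (face k a)) *~ (-1) ^+ k.
Proof.
rewrite /eval_seq ffunE big_ord_recl big_ord_recr /= expr0 mulr1z tnth_mktuple.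
rewrite addrA; congr (_ + _ + _).
- congr (gact _ (f _)); apply: eq_mktuple => k.
  by rewrite tnth_mktuple /face.
- apply: eq_bigr => j _; rewrite gact1; congr (f _ *~ _).
  apply: eq_mktuple => k; rewrite !tnth_mktuple /face /= /bump leq0n add1n.
  have -> : (i <= k)%N = false by rewrite leqNgt ltn_ord.
  by rewrite ltnS eqSS.
rewrite gact1; congr (f _ *~ _); apply: eq_mktuple => k.
by rewrite tnth_mktuple /face /= /bump leqNgt !ltnS !ltn_ord.
Qed.

(** The sum over the rectangle of pairs (k, l) cancels in pairs: (k + 1, l) with
    l <= k is matched with (l, k).  This is the cancellation behind d d = 0. *)
Lemma sum_alternating (V : zmodType) (m : nat) (e : nat -> nat -> V) :
  (forall k l, (l <= k < m)%N -> e k.+1 l + e l k = 0) ->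
  \sum_(k < m.+1) \sum_(l < m) e k l = 0.
Proof.
elim: m => [|m IH] eP.
  by rewrite big1 // => k _; rewrite big_ord0.
rewrite big_ord_recr /=.
under eq_bigr do rewrite big_ord_recr /=.
rewrite big_split /= IH => [|k l /andP[lk km]]; last by rewrite eP // lk ltnW.
rewrite add0r addrC -big_split /= big1 // => l _.
by rewrite eP // -ltnS ltn_ord /= ltnS.
Qed.

Lemma coboundaryK (i : nat) (f : cochain M i) : coboundary (coboundary f) = 0.
Proof.
apply/ffunP => s; rewrite eval_nth coboundaryE [RHS]ffunE.
move: (nth _ s) => a.
pose e k l := gact (face_coef k a * face_coef l (face k a))%g
  (eval_seq f (face l (face k a))) *~ ((-1) ^+ k * (-1) ^+ l).
rewrite -[RHS](@sum_alternating _ i.+2 e) => [|k l /andP[lk km]].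
  apply: eq_bigr => k _; rewrite coboundaryE raddf_sum /= mulrz_suml.
  apply: eq_bigr => l _.
  by rewrite raddfMz /= -gactM -mulrzA mulrC.
rewrite /e face_coefM //.
rewrite (eq_eval_seq f (fun m _ => face_face a lk m)).
by rewrite -mulrzDr exprS mulN1r mulNr mulrC addNr mulr0z.
Qed.

Lemma coboundaryMn (i : nat) (f : cochain M i) (m : nat) :
  coboundary (f *+ m) = coboundary f *+ m.
Proof. exact: raddfMn. Qed.

(** Up to a sign and the factor #|G| this is the homotopy by which averaging
    over G shows that the order of G annihilates higher cohomology. *)
Definition sum_last (i : nat) (f : cochain M i.+1) : cochain M i :=
  [ffun s : i.-tuple G => \sum_x f (rcons_tuple s x)].

Definition set_at (i : nat) (a : nat -> G) (x : G) (k : nat) : G :=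
  if k == i then x else a k.

Lemma eval_sum_last (i : nat) (f : cochain M i.+1) (a : nat -> G) :
  eval_seq (sum_last f) a = \sum_x eval_seq f (set_at i a x).
Proof.
rewrite /eval_seq ffunE; apply: eq_bigr => x _; congr (f _).
apply/eq_from_tnth => k; rewrite (tnth_nth 1%g) /= nth_rcons tnth_mktuple /set_at.
rewrite size_map size_enum_ord; case: ltngtP => ki.
- by have /= := nth_mktuple (fun k => a (nat_of_ord k)) 1%g (Ordinal ki).
- by have := ltn_ord k; rewrite ltnS leqNgt ki.
- by [].
Qed.

(** Sum the cocycle identity over its last argument x.  The face that multiplies
    x by the argument before it becomes the last face of the summed cochain,
    after a change of variable in x; the face that forgets x contributes #|G|
    equal terms. *)
Lemma coboundary_sum_last (i : nat) (f : cochain M i.+1) :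
  coboundary f = 0 -> coboundary (sum_last f) = f *~ (-1) ^+ i.+1 *+ #|G|.
Proof.
move=> df; apply/ffunP => s.
rewrite cochainMn [LHS]eval_nth coboundaryE.
have -> : (f *~ (-1) ^+ i.+1) s = eval_seq f (nth 1%g s) *~ (-1) ^+ i.+1.
  by rewrite (eval_nth (f *~ _)) /eval_seq ffunMzE.
move: (nth _ s) => a.
have sum_df : \sum_x eval_seq (coboundary f) (set_at i.+1 a x) = 0.
  by rewrite df big1 // => x _; rewrite /eval_seq ffunE.
apply/eqP; rewrite -subr_eq0 -[X in _ == X]sum_df; apply/eqP.
under [RHS]eq_bigr do rewrite coboundaryE big_ord_recr /=.
rewrite big_split /=; congr (_ + _); last first.
  rewrite -mulNrn -mulNrz.
  transitivity (\sum_(x : G) eval_seq f a *~ (-1) ^+ i.+2).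
    by rewrite sumr_const [(-1) ^+ i.+2]exprS mulN1r mulrNz mulNrz.
  apply: eq_bigr => x _; rewrite gact1; congr (_ *~ _).
  by apply: eq_eval_seq => m mi; rewrite /face ltnS mi /set_at ltn_eqF.
rewrite exchange_big /=; apply: eq_bigr => k _.
rewrite eval_sum_last raddf_sum /= mulrz_suml.
have [ki|ki] := ltnP k i.+1.
  apply: eq_bigr => x _; congr (gact _ _ *~ _).
  by apply: eq_eval_seq => m mi; rewrite /face /set_at; repeat case: ifP => ? //; lia.
have -> : nat_of_ord k = i.+1 by apply/eqP; rewrite eqn_leq ki -ltnS ltn_ord.
rewrite (reindex_inj (mulgI (a i))) /=; apply: eq_bigr => x _.
congr (gact _ _ *~ _).
by apply: eq_eval_seq => m mi; rewrite /face /set_at; repeat case: ifP => ? //; 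
   do ?[lia | congr (_ * _)%g; congr (a _); lia].
Qed.

End Bar.

(** * Cohomology classes and finite abelian groups *)

Local Open Scope classical_set_scope.
Local Open Scope card_scope.

(** Makes the theorems of Cauchy and Lagrange applicable to a group that is only
    known to be finite in the set-theoretic sense. *)
Lemma finite_zmodType (H : zmodType) : finite_set [set: H] ->
  exists F : finZmodType, (F : zmodType) = H.
Proof.
case/finite_seqP => s sE.
have mem_s (x : H) : x \in s by have : [set: H] x by []; rewrite sE.
case: H s sE mem_s => H c s sE mem_s.
have indexK : pcancel (fun x => index x s) (onth s).
  by move=> x; rewrite onthE (nth_map x) ?index_mem // nth_index.
have enumP : Finite.axiom (undup s).
  by apply: Finite.uniq_enumP; rewrite ?undup_uniq // => x; rewrite mem_undup mem_s.
pose C := PCanIsCountable indexK.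
pose F : finZmodType := HB.pack H c C (isFinite.Build (GRing.Zmodule.Pack c) enumP).
by exists F.
Qed.

Lemma card_finType (F : finType) : [set: F] #= `I_#|F|.
Proof.
apply: card_eq_trans (card_esym (@card_II #|F|)).
have <- : (@enum_rank F) @` [set: F] = [set: 'I_#|F|].
  by apply/seteqP; split => // k _; exists (enum_val k); rewrite ?enum_valK.
by rewrite card_eq_sym; apply: inj_card_eq => x y _ _; apply: enum_rank_inj.
Qed.

(** Cauchy in one direction, Lagrange in the other. *)
Lemma finite_torsionP (H : zmodType) (p : nat) : prime p ->
  finite_set [set: H] ->
  (exists2 k, [set: H] #= `I_k & (p %| k)%N) <->
  (exists2 x : H, x != 0 & x *+ p = 0).
Proof.
move=> p_pr /finite_zmodType[F <-]; split=> [[k Hk pk]|[x x_neq0 xp]].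
  have kF : k = #|F|.
    by apply/card_eq_II; apply: card_eq_trans (card_finType F); apply: card_esym.
  have [x _ ox] : {x : F | x \in [set: F]%SET & #[x]%g = p}.
    by apply: Cauchy; rewrite // cardsT -kF.
  exists x; last by rewrite -FinRing.zmodXgE -ox expg_order.
  by apply/eqP => x0; move: p_pr; rewrite -ox x0 (@order1 F).
exists #|F|; first exact: card_finType.
have <- : #[x : F]%g = p.
  by apply: nt_prime_order.
by rewrite -cardsT order_dvdG ?inE.
Qed.

Lemma finite_surj_inj (T : finType) (f : T -> T) :
  (forall y, exists x, f x = y) -> injective f.
Proof.
move=> surj; have fT : #|[seq f x | x in T]| == #|T|.
  apply/eqP/eq_card => y; rewrite [RHS]inE; apply/fintype.imageP.
  by have [x <-] := surj y; exists x.
by move=> x y; move/image_injP: fT; apply.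
Qed.

(** Multiplication by p is an endomorphism of a finite group, hence it is
    surjective iff it is injective. *)
Lemma finite_divisibleP (H : zmodType) (p : nat) :
  finite_set [set: H] ->
  (exists x : H, forall y, x != y *+ p) <->
  (exists2 x : H, x != 0 & x *+ p = 0).
Proof.
move=> /finite_zmodType[F <-].
split=> [[x xN]|[x x_neq0 xp]].
  have [/injectiveP inj|/injectivePn[y [z yz eq_yz]]] :=
    boolP (injectiveb (fun y : F => y *+ p)).
    have [g _ gK] := injF_bij inj.
    by have := xN (g x); rewrite gK eqxx.
  exists (y - z); first by rewrite subr_eq0.
  by rewrite mulrnBl eq_yz subrr.
apply: contrapT => /forallNP dv; move/eqP: x_neq0; apply.
apply: (@finite_surj_inj F (fun y => y *+ p)) => [y|]; last by rewrite xp mul0rn.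
by have /existsNP[z /negP/negPn/eqP yz] := dv y; exists z.
Qed.

Section Classes.
Variables (G : finGroupType) (M : gmodule G) (i : nat).
Implicit Types (z w : cochain M i).

Lemma class_eq0 (z : cocycle M i) :
  \pi_(cohomology M i)%qT z = 0 <-> is_coboundary (val z).
Proof.
have -> : is_coboundary (val z) <-> z \in @boundary_pred G M i.
  by split => /asboolP.
rewrite -[z in X in _ <-> X]subr0 Quotient.idealrBE.
by rewrite raddf0; split=> /eqP.
Qed.

Lemma classP (x : cohomology M i) :
  exists z : cocycle M i, x = \pi_(cohomology M i)%qT z.
Proof. by elim/quotW: x => z; exists z. Qed.

Lemma cocycleP z : coboundary z = 0 -> exists c : cocycle M i, val c = z.
Proof.
by move=> /eqP dz; have zP : z \in @cocycle_pred G M i := dz; exists (Cocycle zP).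
Qed.

Lemma coboundary_val (c : cocycle M i) : coboundary (val c) = 0.
Proof. by apply/eqP; have := valP c. Qed.

Lemma cohomology_neq0P :
  (exists x : cohomology M i, x != 0) <->
  (exists2 z : cochain M i, coboundary z = 0 & ~ is_coboundary z).
Proof.
split=> [[x]|[z /cocycleP[c <-] cN]].
  have [c ->] := classP x => /eqP cN.
  exists (val c); first exact: coboundary_val.
  by move/class_eq0.
by exists (\pi_(cohomology M i)%qT c); apply/eqP => /class_eq0.
Qed.

Lemma cohomology_torsionP (p : nat) :
  (exists2 x : cohomology M i, x != 0 & x *+ p = 0) <->
  (exists2 z : cochain M i, coboundary z = 0 & ~ is_coboundary z /\ is_coboundary (z *+ p)).
Proof.
split=> [[x]|[z /cocycleP[c <-] [cN cp]]].
  have [c ->] := classP x => /eqP cN.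
  rewrite -raddfMn => /class_eq0; rewrite raddfMn => cp.
  exists (val c); first exact: coboundary_val.
  by split=> // /class_eq0.
exists (\pi_(cohomology M i)%qT c); first by apply/eqP => /class_eq0.
by rewrite -raddfMn; apply/class_eq0; rewrite raddfMn.
Qed.

Lemma cohomology_nondivP (p : nat) :
  (exists x : cohomology M i, forall y, x != y *+ p) <->
  (exists2 z : cochain M i, coboundary z = 0 &
     forall w : cochain M i, coboundary w = 0 -> ~ is_coboundary (z - w *+ p)).
Proof.
split=> [[x]|[z /cocycleP[c <-] cN]].
  have [c ->] := classP x => xN.
  exists (val c) => [|_ /cocycleP[w <-]]; first exact: coboundary_val.
  rewrite -raddfMn -raddfB => /class_eq0/eqP.
  by rewrite raddfB raddfMn subr_eq0; apply/negP; apply: xN.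
exists (\pi_(cohomology M i)%qT c) => y; have [w ->] := classP y.
apply/negP; rewrite -subr_eq0 -raddfMn -raddfB => /eqP/class_eq0.
by rewrite raddfB raddfMn; apply: cN; apply: coboundary_val.
Qed.

End Classes.

(** * Multiplication by p and the universal coefficient sequence *)

Lemma coboundary_of_coboundary (G : finGroupType) (M : gmodule G) (i : nat)
  (f : cochain M i) : is_coboundary f -> coboundary f = 0.
Proof.
by case: i f => [|i] f /= => [->|[h ->]]; rewrite ?raddf0 ?coboundaryK.
Qed.

Lemma cochain_mulrn_eq0 (G : finGroupType) (M : gmodule G) (m : nat) :
  (forall x : M, x *+ m = 0 -> x = 0) ->
  forall (i : nat) (f : cochain M i), f *+ m = 0 -> f = 0.
Proof.
move=> tf i f /ffunP fm; apply/ffunP => s; rewrite [RHS]ffunE; apply: tf.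
by have := fm s; rewrite cochainMn [X in _ = X -> _]ffunE.
Qed.

Section Reduction.
Variables (G : finGroupType) (M N : gmodule G) (p : nat) (pi : {additive M -> N}).
Hypothesis pi_act : forall g x, pi (gact g x) = gact g (pi x).
Hypothesis pi_surj : forall y, exists x, pi x = y.
Hypothesis pi_ker : forall x, pi x = 0 <-> exists y, x = y *+ p.
Hypothesis M_tf : forall x : M, x *+ p = 0 -> x = 0.

Definition map_cochain (i : nat) (f : cochain M i) : cochain N i :=
  [ffun s : i.-tuple G => pi (f s)].

Lemma map_coboundary (i : nat) (f : cochain M i) :
  map_cochain (coboundary f) = coboundary (map_cochain f).
Proof.
apply/ffunP => s; rewrite !ffunE !raddfD /= pi_act !raddfMz raddf_sum.
congr (_ + _ + _); apply: eq_bigr => j _; rewrite ffunE.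
exact: raddfMz.
Qed.

Lemma map_cochain_surj (i : nat) (f : cochain N i) :
  exists h, map_cochain h = f.
Proof.
have /choice[h hP] s := pi_surj (f s).
by exists [ffun s => h s]; apply/ffunP => s; rewrite !ffunE.
Qed.

Lemma map_cochain_eq0 (i : nat) (f : cochain M i) :
  map_cochain f = 0 <-> exists h, f = h *+ p.
Proof.
split=> [f0|[h ->]].
  have /choice[h hP] s : exists y, f s = y *+ p.
    by apply/pi_ker; have /ffunP/(_ s) := f0; rewrite !ffunE.
  exists [ffun s => h s]; apply/ffunP => s.
  by rewrite hP cochainMn ffunE.
apply/ffunP => s; rewrite !ffunE; apply/pi_ker; exists (h s).
by rewrite cochainMn.
Qed.

Lemma map_cochainB (i : nat) (f h : cochain M i) :
  map_cochain (f - h) = map_cochain f - map_cochain h.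
Proof. by apply/ffunP => s; rewrite !ffunE raddfB. Qed.

(** Lift a cochain that bounds the reduction of f; its coboundary differs from f
    by a cochain that vanishes modulo p, that is, by a multiple of p. *)
Lemma is_coboundary_map (i : nat) (f : cochain M i) :
  is_coboundary (map_cochain f) <-> exists w, is_coboundary (f - w *+ p).
Proof.
have mulp0 (w : cochain M i) : map_cochain (w *+ p) = 0.
  by apply/map_cochain_eq0; exists w.
split=> [|[]]; case: i f mulp0 => [|i] f mulp0 /=.
- by move=> /map_cochain_eq0[w ->]; exists w; rewrite subrr.
- case=> h'; have [h <-] := map_cochain_surj h'.
  rewrite -map_coboundary => /eqP; rewrite -subr_eq0 -map_cochainB.
  move=> /eqP/map_cochain_eq0[w eq_w]; exists w; exists h.
  by rewrite -eq_w subKr.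
- by move=> w /eqP; rewrite subr_eq0 => /eqP ->.
move=> w [h eq_h]; exists (map_cochain h).
by rewrite -map_coboundary -eq_h map_cochainB mulp0 subr0.
Qed.

(** The long exact sequence of 0 -> M -p-> M -> N -> 0, read as the exactness of
    0 -> H^i(M) / p -> H^i(N) -> H^(i+1)(M)[p] -> 0.  The connecting map sends
    the reduction of z to w, where d z = p w. *)
Lemma cohomology_mod_neq0P (i : nat) :
  (exists x : cohomology N i, x != 0) <->
  (exists x : cohomology M i, forall y, x != y *+ p) \/
  (exists2 x : cohomology M i.+1, x != 0 & x *+ p = 0).
Proof.
have tf := cochain_mulrn_eq0 M_tf.
split=> [/cohomology_neq0P[z']|[/cohomology_nondivP[z dz zN]|]]; last 2 first.
- apply/cohomology_neq0P; exists (map_cochain z).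
    rewrite -map_coboundary dz; apply/map_cochain_eq0.
    by exists 0; rewrite mul0rn.
  case/is_coboundary_map => w zw; apply: (zN w) (zw).
  apply: tf; rewrite -coboundaryMn; move: (coboundary_of_coboundary zw).
  by rewrite coboundaryB dz sub0r => /eqP; rewrite oppr_eq0 => /eqP.
- case/cohomology_torsionP => z dz [zN [h dh]]; apply/cohomology_neq0P.
  exists (map_cochain h).
    by rewrite -map_coboundary -dh; apply/map_cochain_eq0; exists z.
  case/is_coboundary_map => w /coboundary_of_coboundary/eqP.
  rewrite coboundaryB subr_eq0 -dh coboundaryMn -subr_eq0 -mulrnBl => /eqP/tf/eqP.
  by rewrite subr_eq0 => /eqP zw; apply: zN; exists w.
have [z <-] := map_cochain_surj z'.
rewrite -map_coboundary => /map_cochain_eq0[w dz] zN.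
have dw : coboundary w = 0 by apply: tf; rewrite -coboundaryMn -dz coboundaryK.
have [[v wv]|wN] := pselect (is_coboundary w); [left|right].
  apply/cohomology_nondivP; exists (z - v *+ p).
    by rewrite coboundaryB coboundaryMn -wv dz subrr.
  move=> u du; rewrite -addrA -opprD -mulrnDl => zv.
  by apply: zN; apply/is_coboundary_map; exists (v + u).
by apply/cohomology_torsionP; exists w => //; split=> //; exists z.
Qed.

End Reduction.

Section Finiteness.
Variables (G : finGroupType) (M : gmodule G).
Hypothesis M_tf : forall x : M, x *+ #|G| = 0 -> x = 0.

Lemma mulrn_card_is_coboundary (i : nat) (f : cochain M i.+1) :
  coboundary f = 0 -> is_coboundary (f *+ #|G|).
Proof.
move=> /coboundary_sum_last df; exists (sum_last f *~ (-1) ^+ i.+1).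
rewrite raddfMz /= df.
by rewrite !(pmulrn _ #|G|) -!mulrzA mulrCA -expr2 sqrr_sign mulr1.
Qed.

Variables (F : finType) (r : M -> F).
Hypothesis r_inj : forall x y, r x = r y -> exists u, x - y = u *+ #|G|.

(** H^(i+1)(M) is a quotient of the cocycles modulo #|G|, which inject into
    functions with values in a finite set. *)
Lemma finite_cohomology (i : nat) : finite_set [set: cohomology M i.+1].
Proof.
have /choice[c cP] := @classP G M i.+1.
pose res x := [ffun s => r (val (c x) s)].
have res_inj : injective res.
  move=> x y /ffunP eq_res; apply/eqP; rewrite -subr_eq0; apply/eqP.
  have /choice[u uP] s : exists u, val (c x) s - val (c y) s = u *+ #|G|.
    by apply: r_inj; have := eq_res s; rewrite !ffunE.
  pose f : cochain M i.+1 := [ffun s => u s].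
  have fE : val (c x) - val (c y) = f *+ #|G|.
    by apply/ffunP => s; rewrite cochainMn !ffunE uP.
  rewrite [x]cP [y]cP -raddfB; apply/class_eq0; rewrite raddfB fE.
  apply: mulrn_card_is_coboundary; apply: (cochain_mulrn_eq0 M_tf).
  by rewrite -coboundaryMn -fE coboundaryB !coboundary_val subrr.
have := inj_card_eq (A := [set: _]) (in2W res_inj).
by move/eq_finite_set <-; apply: finite_finset.
Qed.

End Finiteness.

(** * Specht modules over the integers and modulo p *)

Section Lattice.
Variables (n : nat) (la : seq nat).
Hypothesis la_part : is_partition n la.
Implicit Types (T : tabloid n la) (x y : specht n la int).

(** Specht modules over Z are pure in the permutation module: the Garnir
    equations are inherited by the quotient by m. *)
Lemma specht_dvd (m : nat) x : (0 < m)%N ->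
  (forall T, (m %| val x T)%Z) -> exists y, x = y *+ m.
Proof.
move=> m_gt0 xm; pose v : perm_module n la int := [ffun T => (val x T %/ m)%Z].
have vE T : val x T = v T *+ m.
  by rewrite ffunE -mulr_natr natz divzK.
have vS : v \in @specht_pred n la int.
  apply: garnir_specht => // r r' D T rr' rD.
  have /eqP := specht_garnir la_part (valP x) T rr' rD.
  under eq_bigr do rewrite vE.
  by rewrite sumrMnl mulrn_eq0 -leqn0 leqNgt m_gt0 => /eqP.
exists (Specht vS); apply/val_inj/ffunP => T.
by rewrite raddfMn /= vE; exact/esym/(ffunMzE _ m%:Z).
Qed.

Lemma specht_mulrn_eq0 (m : nat) x : (0 < m)%N -> x *+ m = 0 -> x = 0.
Proof.
move=> m_gt0 xm; apply/val_inj/ffunP => T; apply/eqP.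
have : (val x *+ m) T = 0 by rewrite -raddfMn xm ffunE.
have -> : (val x *+ m) T = val x T *+ m by exact: (ffunMzE _ m%:Z).
by rewrite ffunE => /eqP; rewrite mulrn_eq0 -leqn0 leqNgt m_gt0.
Qed.

(** S_Z / m S_Z embeds into the tuples of coefficients modulo m. *)
Lemma specht_residues (m : nat) : (0 < m)%N ->
  exists (F : finType) (res : specht n la int -> F),
  forall x y, res x = res y -> exists z, x - y = z *+ m.
Proof.
move=> m_gt0; exists {ffun tabloid n la -> 'I_m}.
have res_lt (a : int) : (`|(a %% m)%Z| < m)%N.
  by rewrite -ltz_nat gez0_abs ?modz_ge0 ?ltz_pmod // -lt0n.
exists (fun x => [ffun T => Ordinal (res_lt (val x T))]) => x y /ffunP eq_res.
apply: specht_dvd => // T; have := congr1 val (eq_res T); rewrite !ffunE /=.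
move=> /(congr1 Posz); rewrite !gez0_abs ?modz_ge0 -?lt0n // => /eqP.
by rewrite eqz_mod_dvd.
Qed.

Section Mod.
Variables (p : nat) (p_pr : prime p).

Definition perm_module_mod (v : perm_module n la int) : perm_module n la 'F_p :=
  [ffun T => (v T)%:~R].

Fact perm_module_mod_additive : zmod_morphism perm_module_mod.
Proof. by move=> v w; apply/ffunP => T; rewrite !ffunE rmorphB. Qed.

HB.instance Definition _ :=
  GRing.isZmodMorphism.Build (perm_module n la int) (perm_module n la 'F_p)
    perm_module_mod perm_module_mod_additive.

Lemma perm_module_modZ (a : int) v :
  perm_module_mod (a *: v) = a%:~R *: perm_module_mod v.
Proof. by apply/ffunP => T; rewrite !ffunE rmorphM. Qed.

Lemma perm_module_mod_polytabloid (t : tableau n la) :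
  perm_module_mod (polytabloid int t) = polytabloid 'F_p t.
Proof.
rewrite raddf_sum /=; apply: eq_bigr => s _; rewrite perm_module_modZ rmorph_sign.
by congr (_ *: _); apply/ffunP => T; rewrite !ffunE; case: (_ == _).
Qed.

Fact specht_mod_subproof x : perm_module_mod (val x) \in @specht_pred n la 'F_p.
Proof.
have /asboolP[c ->] := valP x; apply/asboolP; exists (fun t => (c t)%:~R).
rewrite raddf_sum /=; apply: eq_bigr => t _.
by rewrite perm_module_modZ perm_module_mod_polytabloid.
Qed.

Definition specht_mod x : specht n la 'F_p := Specht (specht_mod_subproof x).

Fact specht_mod_additive : zmod_morphism specht_mod.
Proof.
move=> x y; apply: val_inj; rewrite [RHS]raddfB.
exact: (raddfB perm_module_mod (val x) (val y)).
Qed.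

HB.instance Definition _ :=
  GRing.isZmodMorphism.Build (specht n la int) (specht n la 'F_p)
    specht_mod specht_mod_additive.

Lemma specht_mod_act (g : 'S_n) x :
  specht_mod (specht_act g x) = specht_act g (specht_mod x).
Proof. by apply/val_inj/ffunP => T; rewrite /= !ffunE. Qed.

Lemma specht_mod_surj (y : specht n la 'F_p) : exists x, specht_mod x = y.
Proof.
have /asboolP[c cP] := valP y.
have xS : \sum_t (c t : nat)%:Z *: polytabloid int t \in @specht_pred n la int.
  by apply/asboolP; exists (fun t => (c t : nat)%:Z).
exists (Specht xS); apply: val_inj; rewrite /= cP raddf_sum /=.
apply: eq_bigr => t _; rewrite perm_module_modZ perm_module_mod_polytabloid.
by congr (_ *: _); rewrite -pmulrn natr_Zp.
Qed.

Lemma specht_mod_ker x : specht_mod x = 0 <-> exists y, x = y *+ p.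
Proof.
split=> [x0|[y ->]]; last first.
  by rewrite raddfMn -scaler_nat pchar_Fp_0 // scale0r.
apply: specht_dvd (prime_gt0 p_pr) _ => T.
have /(congr1 val)/ffunP/(_ T) := x0; rewrite !ffunE => /eqP.
by rewrite -(dvdz_pcharf (pchar_Fp p_pr)).
Qed.

(** Descent on the absolute value of a nonzero coefficient. *)
Lemma specht_p_part x : x != 0 ->
  exists e y, x = y *+ p ^ e /\ forall w, y != w *+ p.
Proof.
move=> x_neq0; have [T xT] : exists T, val x T != 0.
  apply/existsP; apply: contraNT x_neq0 => /existsPn x0.
  by apply/eqP/val_inj/ffunP => T; rewrite [RHS]ffunE; apply/eqP/negbNE/x0.
have [N] := ubnP `|val x T|%N; elim: N x xT {x_neq0} => // N IH x xT xN.
have [[y xy]|nd] := pselect (exists y, x = y *+ p); last first.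
  exists 0%N, x; split=> // w; apply: contra_notN nd => /eqP xw; by exists w.
have xyT : val x T = val y T *+ p.
  by rewrite xy raddfMn; exact: (ffunMzE _ p%:Z).
have yT : val y T != 0 by apply: contraNneq xT => y0; rewrite xyT y0 mul0rn.
have [|e [z [yz zP]]] := IH y yT.
  rewrite -ltnS; apply: leq_trans xN; rewrite ltnS xyT -mulr_natr abszM natz absz_nat.
  by rewrite ltn_Pmulr ?prime_gt1 // absz_gt0.
by exists e.+1, z; split=> //; rewrite xy yz -mulrnA expnSr.
Qed.

End Mod.

Lemma tabloid_transitive T T' : exists g, tabloid_act g T = T'.
Proof.
have /existsP[t Tt] := valP T; have /existsP[t' Tt'] := valP T'.
have [f tK fK] := tableau_bij la_part t.
have inj_g : injective (fun i => f (val t' i)).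
  by apply: inj_comp (can_inj fK) _; apply/injectiveP/(valP t').
exists (perm inj_g); apply/val_inj/ffunP => i.
by rewrite ffunE permE (eqP Tt) (eqP Tt') !ffunE fK.
Qed.

(** An invariant is constant by transitivity; with two rows available, the
    Garnir equation for all letters of the first two rows then sums a positive
    number of copies of a nonzero integer. *)
Lemma specht_invariant_size x : x != 0 -> (forall g, specht_act g x = x) ->
  (size la <= 1)%N.
Proof.
move=> x_neq0 x_inv; have [T0 xT0] : exists T, val x T != 0.
  apply/existsP; apply: contraNT x_neq0 => /existsPn x0.
  by apply/eqP/val_inj/ffunP => T; rewrite [RHS]ffunE; apply/eqP/negbNE/x0.
have x_const T : val x T = val x T0.
  have [g <-] := tabloid_transitive T0 T.
  by rewrite -{1}(x_inv g) ffunE tabloid_actK.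
rewrite leqNgt; apply/negP => size_la.
pose r := Ordinal (ltnW size_la); pose r' := Ordinal size_la.
pose D := [set i | val T0 i == r] :|: [set i | val T0 i == r'].
have rD : (nth 0 la r < #|D|)%N.
  rewrite cardsU disjoint_setI0 ?cards0 ?subn0; last first.
    rewrite -setI_eq0; apply/eqP/setP => i; rewrite !inE.
    by case: (eqVneq (val T0 i) r) => [->|].
  rewrite !card_row // -[X in (X < _)%N]addn0 ltn_add2l lt0n.
  have /and3P[_ la_pos _] := la_part.
  by apply: contraNneq la_pos => <-; apply: mem_nth.
have := specht_garnir la_part (valP x) T0 (leq0n r' : (r <= r')%N) rD.
rewrite (eq_bigr _ (fun T _ => x_const T)) sumr_const => /eqP.
rewrite mulrn_eq0 (negPf xT0) orbF => /pred0P/(_ T0)/negP; apply.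
by apply/reshuffleP; split=> // i; rewrite !inE => /orP[]/eqP; [left|right].
Qed.

Lemma specht_act_trivial (g : 'S_n) x : (size la <= 1)%N -> specht_act g x = x.
Proof.
move=> size_la; apply/val_inj/ffunP => T; rewrite ffunE; congr (val x _).
apply/val_inj/ffunP => i; apply: val_inj.
have row0 (r : 'I_(size la)) : r = 0 :> nat.
  by apply/eqP; rewrite -leqn0 -ltnS (leq_trans (ltn_ord r)).
by rewrite /= !row0.
Qed.

End Lattice.

Lemma coboundary0E (G : finGroupType) (M : gmodule G) (f : cochain M 0)
  (s : 1.-tuple G) :
  coboundary f s = gact (tnth s ord0) (f [tuple]) - f [tuple].
Proof.
by rewrite ffunE big_ord0 addr0 expr1 mulrN1z [drop_first s]tuple0 [drop_last s]tuple0.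
Qed.

(** Dividing an invariant by the highest possible power of p leaves an invariant
    because M has no p-torsion. *)
Lemma cohomology0_nondivP (G : finGroupType) (M : gmodule G) (p : nat) :
  (forall x : M, x *+ p = 0 -> x = 0) ->
  (forall x : M, x != 0 ->
     exists e y, x = y *+ p ^ e /\ forall w, y != w *+ p) ->
  (exists x : cohomology M 0, forall y, x != y *+ p) <->
  (exists x : cohomology M 0, x != 0).
Proof.
move=> M_tf prim; split=> [[x xP]|/cohomology_neq0P[z dz /eqP zN]].
  by exists x; have := xP 0; rewrite mul0rn.
have zN0 : z [tuple] != 0.
  by apply: contraNneq zN => z0; apply/eqP/ffunP => s; rewrite [s]tuple0 z0 ffunE.
have [e [y [zy yP]]] := prim _ zN0.
pose f : cochain M 0 := [ffun=> y].
have zf : z = f *+ p ^ e.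
  by apply/ffunP => s; rewrite [s]tuple0 zy cochainMn ffunE.
apply/cohomology_nondivP; exists f.
  have tf := cochain_mulrn_eq0 M_tf.
  have : coboundary f *+ p ^ e = 0 by rewrite -coboundaryMn -zf.
  elim: e {zy zf} => // e IH; rewrite expnSr mulrnA => /tf; exact: IH.
move=> w _ /eqP; rewrite subr_eq0 => /eqP fw.
by have := yP (w [tuple]); rewrite -cochainMn -fw ffunE eqxx.
Qed.

(** #|G| times a 1-cocycle is the coboundary of a 0-cochain, which is zero when
    the action is trivial. *)
Lemma cohomology1_trivial_act (G : finGroupType) (M : gmodule G)
    (x : cohomology M 1) :
  (forall x : M, x *+ #|G| = 0 -> x = 0) ->
  (forall (g : G) (x : M), gact g x = x) -> x = 0.
Proof.
move=> M_tf triv; apply: contrapT => /eqP x_neq0.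
have /cohomology_neq0P[z dz zN] : exists x : cohomology M 1, x != 0 by exists x.
apply: zN; exists 0; rewrite raddf0; apply: (cochain_mulrn_eq0 M_tf).
have [h ->] := mulrn_card_is_coboundary dz.
by apply/ffunP => s; rewrite coboundary0E triv subrr ffunE.
Qed.

Section SpechtCohomology.
Variables (n : nat) (la : seq nat).
Hypothesis la_part : is_partition n la.
Variables (p : nat) (p_pr : prime p).
Local Notation M := (specht_module n la int).
Local Notation N := (specht_module n la 'F_p).

Lemma specht_cohomology_modP (i : nat) :
  (exists x : cohomology N i, x != 0) <->
  (exists x : cohomology M i, forall y, x != y *+ p) \/
  (exists2 x : cohomology M i.+1, x != 0 & x *+ p = 0).
Proof.
apply: (@cohomology_mod_neq0P _ M N p (@specht_mod n la p)).
- exact: specht_mod_act.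
- exact: specht_mod_surj.
- exact: specht_mod_ker.
- by move=> x; apply/specht_mulrn_eq0/prime_gt0.
Qed.

Lemma specht_mulrn_card_eq0 (x : M) : x *+ #|{: 'S_n}| = 0 -> x = 0.
Proof. by apply: specht_mulrn_eq0; apply/card_gt0P; exists 1%g. Qed.

Lemma specht_cohomology_finite (i : nat) : finite_set [set: cohomology M i.+1].
Proof.
have [|F [res res_inj]] := @specht_residues n la la_part #|{: 'S_n}|.
  by apply/card_gt0P; exists 1%g.
exact: (finite_cohomology specht_mulrn_card_eq0 res_inj).
Qed.

Lemma specht_torsionP (i : nat) :
  (exists2 k, [set: cohomology M i.+1] #= `I_k & (p %| k)%N) <->
  (exists2 x : cohomology M i.+1, x != 0 & x *+ p = 0).
Proof. exact/finite_torsionP/specht_cohomology_finite. Qed.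

Lemma specht_cohomology_mod_pos (i : nat) :
  (exists x : cohomology N i.+1, x != 0) <->
  (exists2 k, [set: cohomology M i.+1] #= `I_k & (p %| k)%N) \/
  (exists2 k, [set: cohomology M i.+2] #= `I_k & (p %| k)%N).
Proof.
rewrite !specht_torsionP.
by rewrite -(finite_divisibleP p (specht_cohomology_finite i)) specht_cohomology_modP.
Qed.

Lemma specht_cohomology_mod0 :
  (exists x : cohomology N 0, x != 0) <->
  (exists x : cohomology M 0, x != 0) \/
  (exists2 k, [set: cohomology M 1] #= `I_k & (p %| k)%N).
Proof.
rewrite specht_torsionP specht_cohomology_modP cohomology0_nondivP //.
  by move=> x; apply/specht_mulrn_eq0/prime_gt0.
exact: specht_p_part.
Qed.

Lemma specht_cohomology_disjoint :
  (exists x : cohomology M 0, x != 0) ->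
  ~ exists2 k, [set: cohomology M 1] #= `I_k & (p %| k)%N.
Proof.
move=> /cohomology_neq0P[z dz zN] /specht_torsionP[x /eqP x_neq0 _].
apply/x_neq0/cohomology1_trivial_act; first exact: specht_mulrn_card_eq0.
move=> g y; apply: specht_act_trivial.
apply: (@specht_invariant_size n la la_part (z [tuple])).
  apply/eqP => z0; apply: zN; apply/ffunP => s.
  by rewrite [s]tuple0 z0 ffunE.
move=> h; apply/eqP; rewrite -subr_eq0.
have := coboundary0E z [tuple of [:: h]].
by rewrite dz ffunE (tnth_nth 1%g) /= => <-.
Qed.

End SpechtCohomology.

Theorem lemma1p1 (p : nat) (hp : prime p) :
  (forall i : nat, (1 <= i)%N ->
     C_coeff i 'F_p = C_tors i p `|` C_tors i.+1 p) /\
  (C_coeff 0 'F_p = C_coeff 0 int `|` C_tors 1 p /\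
   C_coeff 0 int `&` C_tors 1 p = set0).
Proof.
split=> [[//|i] _|]; last split.
- apply/seteqP; split=> la.
    case=> n _ [la_part /(specht_cohomology_mod_pos la_part hp)[]] Hk.
      by left; exists n.
    by right; exists n.
  by case=> -[n _ [la_part Hk]]; exists n => //; split=> //;
    apply/(specht_cohomology_mod_pos la_part hp); [left|right].
- apply/seteqP; split=> la.
    case=> n _ [la_part /(specht_cohomology_mod0 la_part hp)[]] Hk.
      by left; exists n.
    by right; exists n.
  by case=> -[n _ [la_part Hk]]; exists n => //; split=> //;
    apply/(specht_cohomology_mod0 la_part hp); [left|right].
rewrite -subset0 => la [[n _ [la_part Hx]] [m _ [la_part' Hk]]].
have mn : m = n.
  have /and3P[_ _ /eqP <-] := la_part.
  by have /and3P[_ _ /eqP <-] := la_part'.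
by rewrite mn in Hk; case: (specht_cohomology_disjoint la_part hp Hx Hk).
Qed.
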